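(* There is no skew-symmetric amorphous association scheme with $4$ classes.
   Context: Let $X$ be a finite set with $|X|\ge 2$ and $R=\{R_0,\dots,R_d\}$ a set of binary relations on $X$. $(X,R)$ is an association scheme with $d$ classes if: (i) $R$ partitions $X\times X$ and $R_0=\{(x,x):x\in X\}$; (ii) for each $i$, the inverse $R_i^{T}=\{(y,x):(x,y)\in R_i\}$ equals $R_{i'}$ for some $i'$; (iii) for all $i,j,k$ there is an integer $p^k_{ij}$ such that for every $(x,y)\in R_k$, $|\{z:(x,z)\in R_i,(z,y)\in R_j\}|=p^k_{ij}$. $R_i$ is symmetric if $R_i^T=R_i$. The scheme is skew-symmetric if $R_0$ is its only symmetric relation. A partition $\Lambda_0,\Lambda_1,\dots,\Lambda_e$ of the index set $\{0,1,\dots,d\}$ is admissible if $\Lambda_0=\{0\}$, each $\Lambda_i$ is nonempty, and for each $i$ the set $\Lambda_i^T=\{\alpha':\alpha\in\Lambda_i\}$ equals some $\Lambda_j$. Given such a partition, set $R_{\Lambda_i}=\bigcup_{\alpha\in\Lambda_i}R_\alpha$; if $(X,\{R_{\Lambda_i}\}_{i=0}^e)$ is an association scheme it is called a fusion scheme. The scheme is amorphous if every admissible partition of $\{0,\dots,d\}$ gives rise to a fusion scheme. *)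

(* Defs.v *)
From mathcomp Require Import all_boot.
Set Implicit Arguments.
Unset Strict Implicit.
Unset Printing Implicit Defensive.

Definition rel_inv (X : finType) (A : {set X * X}) : {set X * X} :=
  [set p | (p.2, p.1) \in A].

Definition diag (X : finType) : {set X * X} := [set p | p.1 == p.2].

(* [F 0, ..., F n] are the pairwise distinct blocks of a partition of [T];
   nonemptiness of the blocks is part of [partition]. *)
Definition indexed_partition (T : finType) (n : nat) (F : 'I_n.+1 -> {set T})
  : Prop :=
  injective F /\ partition [set F i | i : 'I_n.+1] [set: T].

Record assoc_scheme (X : finType) (d : nat) (R : 'I_d.+1 -> {set X * X})
  : Prop := AssocScheme {
  scheme_card : 2 <= #|X|;
  scheme_partition : indexed_partition R;
  scheme_diag : R ord0 = diag X;
  scheme_inv : forall i, exists i', rel_inv (R i) = R i';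
  scheme_inter : forall i j k, exists p : nat,
    forall x y, (x, y) \in R k ->
      #|[set z | ((x, z) \in R i) && ((z, y) \in R j)]| = p
}.

Definition symmetric_rel (X : finType) (A : {set X * X}) : Prop :=
  rel_inv A = A.

Definition skew_symmetric (X : finType) (d : nat) (R : 'I_d.+1 -> {set X * X})
  : Prop :=
  forall i, symmetric_rel (R i) <-> i = ord0.

(* The set of all [a'] with [a] in [L], where [a'] is the index such that
   [R a'] is the inverse of [R a] (unique, as the [R i] are distinct). *)
Definition index_inv (X : finType) (d : nat) (R : 'I_d.+1 -> {set X * X})
  (L : {set 'I_d.+1}) : {set 'I_d.+1} :=
  [set a' | [exists a in L, rel_inv (R a) == R a']].

Record admissible (X : finType) (d : nat) (R : 'I_d.+1 -> {set X * X})
  (e : nat) (L : 'I_e.+1 -> {set 'I_d.+1}) : Prop := Admissible {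
  admissible_partition : indexed_partition L;
  admissible_zero : L ord0 = [set ord0];
  admissible_inv : forall i, exists j, index_inv R (L i) = L j
}.

Definition fusion (X : finType) (d : nat) (R : 'I_d.+1 -> {set X * X})
  (e : nat) (L : 'I_e.+1 -> {set 'I_d.+1}) (i : 'I_e.+1) : {set X * X} :=
  \bigcup_(a in L i) R a.

Definition amorphous (X : finType) (d : nat) (R : 'I_d.+1 -> {set X * X})
  : Prop :=
  forall (e : nat) (L : 'I_e.+1 -> {set 'I_d.+1}),
    admissible R L -> assoc_scheme (fusion R L).

(* Main.v *)
From mathcomp Require Import all_boot all_order all_algebra.
From mathcomp Require Import ring lra zify.
(* [Defs] comes last: mathcomp also has an [indexed_partition]. *)
Require Import Defs.

(* Let [A], [B] be the adjacency matrices of two classes which, with their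
   transposes, make up all the nontrivial classes, let [k], [l] be their
   valencies, and put [M = A + A^T], [P = A - A^T], [Q = B - B^T].  The fusions
   with nontrivial classes [A + B] and [A + B^T] are doubly regular tournaments,
   so [n = 3 (mod 4)] and [(P + Q)^2 = (P - Q)^2 = J - n I], that is,
   [P^2 + Q^2 = J - n I] and [P Q + Q P = 0].  A trace argument shows that [A]
   is normal, hence [P M = u P] and [Q M = v Q] for integers [u], [v].  Then
   [(J - n I) M = u P^2 + v Q^2] and [(J - n I) M^2 = u^2 P^2 + v^2 Q^2], whose
   traces, together with [n = 1 + 2 k + 2 l], give [n = (u - v)^2], which is
   impossible modulo 4. *)

Set Implicit Arguments.
Unset Strict Implicit.
Unset Printing Implicit Defensive.

Import GRing.Theory Num.Theory.
Local Open Scope ring_scope.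

(** * Integer matrices: the span of the classes and the all-ones matrix *)

Local Notation J := (const_mx 1).

Local Ltac mx_ring := apply/matrixP => ? ?; rewrite !mxE; ring.

(** Models the integral Bose-Mesner algebra, with [A], [A^T], [B], [B^T] as the nontrivial
    classes. *)
Definition in_span n (A B C : 'M[int]_n) : Prop :=
  exists c0 c1 c2 c3 c4 : int,
    C = c0%:M + c1 *: A + c2 *: A^T + c3 *: B + c4 *: B^T.

Lemma in_spanC n (A B C : 'M[int]_n) : in_span A B C -> in_span B A C.
Proof.
move=> [c0 [c1 [c2 [c3 [c4 ->]]]]]; exists c0, c3, c4, c1, c2; mx_ring.
Qed.

(** Symmetrising [C] would introduce halves, so [C] is doubled and [C + C^T] is expanded. *)
Lemma in_span_sym n (A B C : 'M[int]_n) :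
    in_span A B C -> C^T = C ->
  exists x y z : int, C + C = x%:M + y *: (A + A^T) + z *: (B + B^T).
Proof.
move=> [c0 [c1 [c2 [c3 [c4 eqC]]]]] symC; exists (c0 + c0), (c1 + c2), (c3 + c4).
rewrite -{2}symC eqC; apply/matrixP => i j; rewrite !mxE eq_sym; ring.
Qed.

Lemma in_span_skew n (A B C : 'M[int]_n) :
    in_span A B C ->
  exists x y : int, C - C^T = x *: (A - A^T) + y *: (B - B^T).
Proof.
move=> [c0 [c1 [c2 [c3 [c4 ->]]]]]; exists (c1 - c2), (c3 - c4).
apply/matrixP => i j; rewrite !mxE eq_sym; ring.
Qed.

Lemma trmxM_self n (A : 'M[int]_n) : (A *m A^T)^T = A *m A^T.
Proof. by rewrite trmx_mul trmxK. Qed.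

Lemma mxtrace_mulJ n (A : 'M[int]_n) (k : int) :
  A *m (J : 'M_n) = k *: J -> \tr (A *m (J : 'M_n)) = k * n%:R.
Proof.
move=> ->; rewrite linearZ /= /mxtrace; congr (_ * _).
by under eq_bigr do rewrite mxE; rewrite sumr_const card_ord.
Qed.

Lemma scale_mx_eq0 m n (a : int) (C : 'M[int]_(m, n)) :
  a *: C = 0 -> C != 0 -> a = 0.
Proof.
move=> aC /eqP C0; case: (eqVneq a 0) => // a0; case: C0.
apply/matrixP => i j; move/matrixP: aC => /(_ i j); rewrite !mxE => /eqP.
by rewrite mulf_eq0 (negPf a0) => /eqP.
Qed.

Lemma mulJJ n : (J : 'M_n) *m (J : 'M_n) = n%:R *: J :> 'M[int]_n.
Proof.
apply/matrixP => i j; rewrite !mxE.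
by under eq_bigr do rewrite !mxE mulr1; rewrite sumr_const card_ord mulr1.
Qed.

Lemma J_neq0 n : (0 < n)%N -> (J : 'M[int]_n) != 0.
Proof.
by move=> n_gt0; apply/eqP => /matrixP /(_ (Ordinal n_gt0) (Ordinal n_gt0)); rewrite !mxE.
Qed.

Lemma natn_neq0 n : (0 < n)%N -> n%:R != 0 :> int.
Proof. by rewrite pnatr_eq0 -lt0n. Qed.

Lemma trmxJ n : (J : 'M[int]_n)^T = J.
Proof. exact: trmx_const. Qed.

(** * Normality of [A] and the action of [M] on [P] *)

Section SkewPair.

Variables (n : nat) (A B : 'M[int]_n) (k l : int).
Hypothesis n_gt0 : (0 < n)%N.
Hypotheses (k_gt0 : 0 < k) (l_gt0 : 0 < l).
Hypothesis sum_all : 1%:M + (A + A^T) + (B + B^T) = J.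
Hypotheses (AJ : A *m (J : 'M_n) = k *: J) (JA : (J : 'M_n) *m A = k *: J).
Hypotheses (BJ : B *m (J : 'M_n) = l *: J) (JB : (J : 'M_n) *m B = l *: J).
Hypotheses (trA : \tr A = 0) (trB : \tr B = 0).
Hypotheses (trAA : \tr (A *m A) = 0).
Hypotheses (trAAt : \tr (A *m A^T) = k * n%:R).
Hypotheses (trAB : \tr (A *m B) = 0) (trABt : \tr (A *m B^T) = 0).
Hypotheses (spanAAt : in_span A B (A *m A^T)) (spanAtA : in_span A B (A^T *m A)).
Hypothesis spanAA : in_span A B (A *m A).

Local Notation M := (A + A^T).
Local Notation N := (B + B^T).
Local Notation P := (A - A^T).
Local Notation Q := (B - B^T).

Lemma AtJ : A^T *m (J : 'M_n) = k *: J.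
Proof. by rewrite -trmxJ -trmx_mul JA linearZ. Qed.

Lemma BtJ : B^T *m (J : 'M_n) = l *: J.
Proof. by rewrite -trmxJ -trmx_mul JB linearZ. Qed.

Lemma MJ : M *m (J : 'M_n) = (k + k) *: J.
Proof. by rewrite mulmxDl AJ AtJ -scalerDl. Qed.

Lemma trM : \tr M = 0.
Proof. by rewrite linearD /= mxtrace_tr trA. Qed.

Lemma trAtAt : \tr (A^T *m A^T) = 0.
Proof. by rewrite -trmx_mul mxtrace_tr. Qed.

Lemma trMM : \tr (M *m M) = (k + k) * n%:R.
Proof.
rewrite mulmxDl !mulmxDr !linearD /= trAA trAtAt (mxtrace_mulC A^T) trAAt; ring.
Qed.

Lemma trPP : \tr (P *m P) = - ((k + k) * n%:R).
Proof.
rewrite mulmxBl !mulmxBr !linearB /= trAA trAtAt (mxtrace_mulC A^T) trAAt; ring.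
Qed.

Lemma trMN : \tr (M *m N) = 0.
Proof.
rewrite mulmxDl !mulmxDr !linearD /= trAB trABt.
rewrite -[A^T *m B]trmxK trmx_mul trmxK mxtrace_tr mxtrace_mulC trABt.
by rewrite -trmx_mul mxtrace_tr mxtrace_mulC trAB.
Qed.

Lemma card_valency : n%:R = 1 + (k + k) + (l + l) :> int.
Proof.
have := congr1 (mulmx^~ (J : 'M[int]_n)) sum_all.
rewrite /= mulJJ !mulmxDl mul1mx AJ AtJ BJ BtJ -{1}[J]scale1r -!scalerDl => /esym eqJ.
apply/eqP; rewrite -subr_eq0; apply/eqP; apply: scale_mx_eq0 (J_neq0 n_gt0).
by rewrite scalerBl eqJ subrr.
Qed.

(** The commutator [D] is symmetric, so [D + D] is a combination of [I], [M], [N]. Its three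
    coefficients vanish in turn: by the trace, by the trace against [M], and by row sums. *)
Lemma commute_trmx : A *m A^T = A^T *m A.
Proof.
have [x [y [z eq1]]] := in_span_sym spanAAt (trmxM_self A).
have symAtA : (A^T *m A)^T = A^T *m A by rewrite trmx_mul trmxK.
have [x' [y' [z' eq2]]] := in_span_sym spanAtA symAtA.
have [D defD] : exists D, D = A *m A^T - A^T *m A by exists (A *m A^T - A^T *m A).
have eqD : D + D = (x - x')%:M + (y - y') *: M + (z - z') *: N.
  transitivity ((A *m A^T + A *m A^T) - (A^T *m A + A^T *m A)).
    by rewrite defD addrACA opprD.
  by rewrite eq1 eq2; mx_ring.
have trD : \tr D = 0 by rewrite defD linearB /= (mxtrace_mulC A^T) subrr.
have x0 : x - x' = 0.
  have := congr1 mxtrace eqD; rewrite !(mxtraceD, mxtraceZ) trD mxtrace_tr trA.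
  rewrite mxtrace_tr trB !(addr0, mulr0) mxtrace_scalar => /esym/eqP.
  by rewrite mulrn_eq0 (gtn_eqF n_gt0) => /eqP.
have trDM : \tr (D *m M) = 0.
  rewrite defD mulmxBl !mulmxDr raddfB /= !mxtraceD.
  have -> : \tr (A *m A^T *m A) = \tr (A^T *m A *m A).
    by rewrite mxtrace_mulC mulmxA mxtrace_mulC mulmxA.
  have -> : \tr (A *m A^T *m A^T) = \tr (A^T *m A *m A^T).
    by rewrite mxtrace_mulC mulmxA.
  by rewrite subrr.
(* Here tr (M M) = 2 k n is nonzero, while tr (N M) = 0. *)
have y0 : y - y' = 0.
  have := congr1 (fun C => \tr (C *m M)) eqD; rewrite /= x0 raddf0 add0r.
  rewrite (mulmxDl D) (mulmxDl (_ *: _)) -!scalemxAl.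
  rewrite (mxtraceD (D *m _)) (mxtraceD (_ *: _)) !mxtraceZ trDM.
  rewrite (mxtrace_mulC N) trMM trMN mulr0 !addr0 => /esym/eqP.
  by rewrite mulf_eq0 mulf_eq0 (negPf (natn_neq0 n_gt0)) orbF => /orP[]/eqP; lia.
(* Both products have row sums k^2, so D J = 0, whereas N J = 2 l J with l > 0. *)
have z0 : z - z' = 0.
  have := congr1 (mulmx^~ (J : 'M[int]_n)) eqD.
  rewrite /= x0 y0 raddf0 scale0r !add0r mulmxDl defD mulmxBl -!mulmxA AJ AtJ.
  rewrite -!scalemxAr AJ AtJ subrr addr0 -scalemxAl mulmxDl BJ BtJ -scalerDl scalerA.
  move/esym/scale_mx_eq0/(_ (J_neq0 n_gt0))/eqP; rewrite mulf_eq0 => /orP[]/eqP; lia.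
have : D + D = 0 by rewrite eqD x0 y0 z0 raddf0 !scale0r !addr0.
move=> /matrixP D0; apply/matrixP => i j; move: (D0 i j).
rewrite defD; set U := A *m _; set V := A^T *m A; rewrite !mxE; lia.
Qed.

(** By normality the mixed terms cancel, which leaves the skew part of [A *m A], to which
    [in_span_skew] applies. *)
Lemma mulPM : P *m M = A *m A - (A *m A)^T.
Proof.
rewrite mulmxBl !mulmxDr commute_trmx trmx_mul.
by move: (A *m A) (A^T *m A) (A^T *m A^T) => U V W; mx_ring.
Qed.

Lemma mulMP : M *m P = P *m M.
Proof.
rewrite mulPM mulmxDl !mulmxBr commute_trmx trmx_mul.
by move: (A *m A) (A^T *m A) (A^T *m A^T) => U V W; mx_ring.
Qed.

Hypothesis trQQ : \tr (Q *m Q) != 0.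
Hypothesis anticomm : P *m Q + Q *m P = 0.

(* [tr (Q P M)] vanishes, since [P] commutes with [M] and anticommutes with [Q]. *)
Lemma mulPM_eigen : exists u : int, P *m M = u *: P.
Proof.
(* The span condition only gives P M = u P + b Q; the trace against [Q] isolates [b]. *)
have [u [b eqPM]] := in_span_skew spanAA; exists u.
rewrite -mulPM in eqPM.
have PQ : P *m Q = - (Q *m P) by apply/eqP; rewrite -addr_eq0 anticomm.
have trQP : \tr (Q *m P) = 0.
  have := congr1 mxtrace anticomm; rewrite mxtraceD (mxtrace_mulC P) raddf0.
  by move/eqP; rewrite -mulr2n mulrn_eq0 => /eqP.
have trQPM : \tr (Q *m (P *m M)) = 0.
  have : \tr (Q *m (P *m M)) = - \tr (Q *m (P *m M)).
    rewrite -[in LHS]mulMP [in LHS]mulmxA [LHS]mxtrace_mulC [in LHS]mulmxA PQ.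
    by rewrite mulNmx raddfN /= mulmxA.
  by move/eqP; rewrite -addr_eq0 -mulr2n mulrn_eq0 => /eqP.
have : b * \tr (Q *m Q) = 0.
  by move: trQPM; rewrite eqPM mulmxDr -!scalemxAr mxtraceD !mxtraceZ trQP mulr0 add0r.
move/eqP; rewrite mulf_eq0 (negPf trQQ) orbF => /eqP b0.
by rewrite eqPM b0 scale0r addr0.
Qed.

End SkewPair.

(** * Doubly regular tournaments *)

(** Symmetry of T T^T forces c1 = c2, so T T^T = (c0 - c1) I + c1 J. Its trace and row sums give c0
    = m and m = 1 + 2 c1, where n = 1 + 2 m; the square is then expanded through T^T = J - I - T. *)
Lemma tournament_sqr n (T : 'M[int]_n) (m : int) (c0 c1 c2 : int) :
    (0 < n)%N -> 0 < m -> 1%:M + T + T^T = J ->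
    T *m (J : 'M_n) = m *: J -> (J : 'M_n) *m T = m *: J ->
    \tr T = 0 -> \tr (T *m T) = 0 -> \tr (T *m T^T) = m * n%:R ->
    T *m T^T = c0%:M + c1 *: T + c2 *: T^T ->
  n%:R = 3 + 4 * c1 /\ (T - T^T) *m (T - T^T) = J - n%:R%:M.
Proof.
move=> n_gt0 m_gt0 sumT TJ JT trT trTT trTTt eqTTt.
have n0 := natn_neq0 n_gt0; have J0 := J_neq0 n_gt0.
have eqTt : T^T = J - 1%:M - T by rewrite -sumT; mx_ring.
have TtJ : T^T *m (J : 'M_n) = m *: J by rewrite -(trmxJ n) -trmx_mul JT linearZ.
have c12 : c1 = c2.
  have : (c1 - c2) *: (T - T^T) = 0.
    have : (T *m T^T)^T = T *m T^T by rewrite trmxM_self.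
    rewrite eqTTt => /matrixP sym; apply/matrixP => i j; move: (sym i j).
    by rewrite !mxE eq_sym => eqij; lra.
  (* The trace against [T] of T - T^T is - m n, which is nonzero. *)
  move/(congr1 (fun C => \tr (T *m C))); rewrite /= mulmx0 -scalemxAr mulmxBr.
  rewrite mxtraceZ raddfB /= trTT trTTt raddf0 sub0r mulrN => /eqP.
  by rewrite oppr_eq0 !mulf_eq0 (negPf n0) orbF => /orP[]/eqP; lia.
have {}eqTTt : T *m T^T = (c0 - c1)%:M + c1 *: J.
  by rewrite eqTTt -c12 -sumT; mx_ring.
have c0m : c0 = m.
  have := congr1 mxtrace eqTTt; rewrite trTTt mxtraceD mxtrace_scalar mxtraceZ.
  have -> : \tr (J : 'M[int]_n) = n%:R.
    by rewrite /mxtrace; under eq_bigr do rewrite mxE; rewrite sumr_const card_ord.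
  by rewrite -[(c0 - c1) *+ n]mulr_natr -mulrDl subrK => /(mulIf n0).
have nm : n%:R = 1 + m + m :> int.
  have := congr1 (mulmx^~ (J : 'M[int]_n)) sumT.
  rewrite /= mulJJ !mulmxDl mul1mx TJ TtJ -{1}[J]scale1r -!scalerDl => /esym eqJ.
  apply/eqP; rewrite -subr_eq0; apply/eqP; apply: scale_mx_eq0 J0.
  by rewrite scalerBl eqJ subrr.
have mc : m = 1 + c1 + c1.
  have := congr1 (mulmx^~ (J : 'M[int]_n)) eqTTt.
  rewrite /= -mulmxA TtJ -scalemxAr TJ mulmxDl mul_scalar_mx -scalemxAl mulJJ.
  rewrite !scalerA -scalerDl => eqJ.
  have : m * m - (c0 - c1 + c1 * n%:R) = 0.
    by apply: scale_mx_eq0 J0; rewrite scalerBl eqJ subrr.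
  rewrite c0m nm => eq0.
  (* Row sums give m^2 = m + 2 m c1, from which [m] is cancelled. *)
  have /eqP : m * (m - (1 + c1 + c1)) = 0 by rewrite -eq0; ring.
  by rewrite mulf_eq0 => /orP[]/eqP; lia.
split; first by lia.
have TtT : T^T *m T = T *m T^T.
  by rewrite eqTt !mulmxBl !mulmxBr JT TJ mul1mx mulmx1.
have TT : T *m T = m *: J - T - T *m T^T.
  by rewrite [in RHS]eqTt !mulmxBr TJ mulmx1 opprB addrCA subrr addr0.
have TtTt : T^T *m T^T = m *: J - T^T - T *m T^T.
  by rewrite -trmx_mul TT !linearB linearZ /= trmxJ trmxM_self.
rewrite mulmxBl !mulmxBr TtT TT TtTt eqTTt eqTt c0m nm mc.
apply/matrixP => i j; rewrite !mxE.
case: (i == j); rewrite ?mulr1n ?mulr0n; ring.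
Qed.

(** This is [tournament_sqr] for T = A + B, a tournament of valency k + l. *)
Lemma tournament_pair_sqr n (A B : 'M[int]_n) (k l c0 c1 c2 : int) :
    (0 < n)%N -> 0 < k -> 0 < l -> 1%:M + (A + A^T) + (B + B^T) = J ->
    A *m (J : 'M_n) = k *: J -> (J : 'M_n) *m A = k *: J ->
    B *m (J : 'M_n) = l *: J -> (J : 'M_n) *m B = l *: J ->
    \tr A = 0 -> \tr B = 0 -> \tr (A *m A) = 0 -> \tr (B *m B) = 0 ->
    \tr (A *m A^T) = k * n%:R -> \tr (B *m B^T) = l * n%:R ->
    \tr (A *m B) = 0 -> \tr (A *m B^T) = 0 ->
    (A + B) *m (A + B)^T = c0%:M + c1 *: (A + B) + c2 *: (A + B)^T ->
  n%:R = 3 + 4 * c1 /\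
  (A - A^T + (B - B^T)) *m (A - A^T + (B - B^T)) = J - n%:R%:M.
Proof.
move=> n_gt0 k_gt0 l_gt0 sum_all AJ JA BJ JB trA trB trAA trBB trAAt trBBt trAB trABt.
move=> eqT; have -> : A - A^T + (B - B^T) = (A + B) - (A + B)^T by mx_ring.
apply: (tournament_sqr (m := k + l) n_gt0) eqT => //.
- lia.
- by rewrite -sum_all; mx_ring.
- by rewrite mulmxDl AJ BJ scalerDl.
- by rewrite mulmxDr JA JB scalerDl.
- by rewrite mxtraceD trA trB.
- by rewrite mulmxDl !mulmxDr !mxtraceD (mxtrace_mulC B A) trAA trAB trBB.
- rewrite raddfD /= mulmxDl !mulmxDr !mxtraceD trAAt trABt trBBt.
  by rewrite -[\tr (B *m A^T)]mxtrace_tr trmx_mul trmxK trABt addr0 add0r mulrDl.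
Qed.

(** * The contradiction for matrices *)

Lemma skew_pair_absurd n (A B : 'M[int]_n) (k l x0 x1 x2 z0 z1 z2 : int) :
    (0 < n)%N -> 0 < k -> 0 < l -> 1%:M + (A + A^T) + (B + B^T) = J ->
    A *m (J : 'M_n) = k *: J -> (J : 'M_n) *m A = k *: J ->
    B *m (J : 'M_n) = l *: J -> (J : 'M_n) *m B = l *: J ->
    \tr A = 0 -> \tr B = 0 -> \tr (A *m A) = 0 -> \tr (B *m B) = 0 ->
    \tr (A *m A^T) = k * n%:R -> \tr (B *m B^T) = l * n%:R ->
    \tr (A *m B) = 0 -> \tr (A *m B^T) = 0 ->
    in_span A B (A *m A) -> in_span A B (A *m A^T) -> in_span A B (A^T *m A) ->
    in_span A B (B *m B) -> in_span A B (B *m B^T) -> in_span A B (B^T *m B) ->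
    (A + B) *m (A + B)^T = x0%:M + x1 *: (A + B) + x2 *: (A + B)^T ->
    (A + B^T) *m (A + B^T)^T = z0%:M + z1 *: (A + B^T) + z2 *: (A + B^T)^T ->
  False.
Proof.
move=> n_gt0 k_gt0 l_gt0 sum_all AJ JA BJ JB trA trB trAA trBB trAAt trBBt trAB trABt.
move=> spAA spAAt spAtA spBB spBBt spBtB eqT eqS.
have n0 := natn_neq0 n_gt0.
have sum_all' : 1%:M + (B + B^T) + (A + A^T) = J by rewrite addrAC.
have trBA : \tr (B *m A) = 0 by rewrite mxtrace_mulC.
have trBAt : \tr (B *m A^T) = 0 by rewrite -mxtrace_tr trmx_mul trmxK.
have [n3 sqT] := tournament_pair_sqr n_gt0 k_gt0 l_gt0 sum_all AJ JA BJ JB trA trB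
  trAA trBB trAAt trBBt trAB trABt eqT.
(* The second fusion is the first one with [B] replaced by its transpose, which turns P + Q into P -
   Q. *)
have [_ sqS] : n%:R = 3 + 4 * z1 /\
    (A - A^T + (B^T - B)) *m (A - A^T + (B^T - B)) = J - n%:R%:M.
  rewrite -{2 4}[B]trmxK.
  apply: (tournament_pair_sqr n_gt0 k_gt0 l_gt0 (l := l)) eqS => //; rewrite ?trmxK //.
  - by rewrite (addrC B^T).
  - by rewrite (BtJ JB).
  - by rewrite -(trmxJ n) -trmx_mul BJ linearZ.
  - by rewrite mxtrace_tr.
  - by rewrite -trmx_mul mxtrace_tr.
  - by rewrite mxtrace_mulC.
have PPtr := trPP trAA trAAt; have QQtr := trPP trBB trBBt.
have nv := card_valency n_gt0 sum_all AJ JA BJ JB.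
have MJk := MJ AJ JA; have trM0 := trM trA; have trMMk := trMM trAA trAAt.
have PPn : \tr ((A - A^T) *m (A - A^T)) != 0.
  by rewrite PPtr oppr_eq0 mulf_neq0 //; lia.
have QQn : \tr ((B - B^T) *m (B - B^T)) != 0.
  by rewrite QQtr oppr_eq0 mulf_neq0 //; lia.
have eigP := mulPM_eigen n_gt0 k_gt0 l_gt0 AJ JA BJ JB trA trB trAA trAAt trAB trABt
  spAAt spAtA spAA QQn.
(* The same lemma with [A] and [B] exchanged. *)
have eigQ := mulPM_eigen n_gt0 l_gt0 k_gt0 BJ JB AJ JA trB trA trBB trBBt trBA trBAt
  (in_spanC spBBt) (in_spanC spBtB) (in_spanC spBB) PPn.
have eqN : B + B^T = J - 1%:M - (A + A^T) by rewrite -sum_all; mx_ring.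
have QJ : (B - B^T) *m (J : 'M_n) = 0 by rewrite mulmxBl BJ (BtJ JB) subrr.
(* The sums and differences become opaque matrices; [opprB] identifies [Q'] with - Q. *)
move: {PPn QQn spAA spAAt spAtA spBB spBBt spBtB eqT eqS sum_all sum_all'}
  (A - A^T) (A + A^T) (B - B^T) (B^T - B) (opprB B B^T) PPtr QQtr MJk trM0 trMMk
  eigP eigQ eqN QJ sqT sqS => P M Q Q' <- PPtr QQtr MJk trM0 trMMk eigP eigQ eqN QJ sqT sqS.
(* Half the difference and half the sum of the two squares, entry by entry. *)
have [anti sumsq] : P *m Q + Q *m P = 0 /\ P *m P + Q *m Q = J - n%:R%:M.
  move: sqT sqS; rewrite !mulmxDl !mulmxDr !mulmxN !mulNmx opprK.
  move: (P *m P) (P *m Q) (Q *m P) (Q *m Q) => U V W Z /matrixP eq1 /matrixP eq2.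
  split; apply/matrixP => i j; move: (eq1 i j) (eq2 i j); rewrite !mxE;
    by move: (n%:R *+ _) => e; lra.
have [u PM] := eigP anti.
have anti' : Q *m P + P *m Q = 0 by rewrite addrC.
(* Here [v] is the eigenvalue of [B + B^T = J - I - M] on [Q], so that of [M] is [- (1 + v)]. *)
have [v QN] := eigQ anti'.
have QM : Q *m M = - (1 + v) *: Q.
  have := QN; rewrite eqN !mulmxBr QJ mulmx1 => eq.
  have -> : Q *m M = - Q - (0 - Q - Q *m M) by move: (Q *m M) => U; mx_ring.
  by rewrite eq; mx_ring.
have trJM : \tr ((J : 'M_n) *m M) = (k + k) * n%:R.
  by rewrite mxtrace_mulC; apply: mxtrace_mulJ.
have trJMM : \tr ((J : 'M_n) *m M *m M) = (k + k) * (k + k) * n%:R.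
  rewrite -mulmxA mxtrace_mulC; apply: mxtrace_mulJ.
  by rewrite -mulmxA MJk -scalemxAr MJk scalerA.
have eq1 : (J - n%:R%:M) *m M = u *: (P *m P) - (1 + v) *: (Q *m Q).
  by rewrite -sumsq mulmxDl -!mulmxA PM QM -!scalemxAr scaleNr.
have eq2 : (J - n%:R%:M) *m M *m M = (u * u) *: (P *m P) + ((1 + v) * (1 + v)) *: (Q *m Q).
  rewrite eq1 mulmxBl -!scalemxAl -!mulmxA PM QM -!scalemxAr !scalerA mulrN scaleNr.
  by rewrite opprK.
(* The trace of [eq1] divided by 2 n; [t2] is that of [eq2] divided by - 2 n. *)
have t1 : k = - (k * u) + l * (1 + v).
  have := congr1 mxtrace eq1; rewrite mulmxBl mul_scalar_mx !raddfB /= !mxtraceZ.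
  rewrite trJM trM0 PPtr QQtr => eq; apply: (mulfI n0); move: eq.
  by move: (n%:R : int) => N; lra.
have t2 : k * n%:R = (k + k) * k + k * (u * u) + l * ((1 + v) * (1 + v)).
  have := congr1 mxtrace eq2; rewrite !mulmxBl mul_scalar_mx -scalemxAl.
  rewrite raddfB mxtraceD /= !mxtraceZ.
  rewrite trJMM trMMk PPtr QQtr => eq; apply: (mulfI n0); move: eq.
  by move: (n%:R : int) => N; lra.
have lv : l * (1 + v) = k * (1 + u) by lia.
have k0 : k != 0 by lia.
have l0 : l != 0 by lia.
(* Multiplying by [l] lets [lv] eliminate [v]; then [k] cancels. *)
have {}t2 : l * n%:R = (k + k) * l + l * (u * u) + k * ((1 + u) * (1 + u)).
  apply: (mulfI k0); transitivity (l * (k * n%:R)); first by ring.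
  rewrite t2; transitivity (l * ((k + k) * k + k * (u * u)) + l * (1 + v) * (l * (1 + v))).
    by ring.
  by rewrite lv; ring.
have sq : n%:R = (u + (1 + v)) ^+ 2.
  apply: (mulfI (mulf_neq0 l0 l0)).
  transitivity ((l * u + l * (1 + v)) ^+ 2); last by ring.
  rewrite lv; apply/eqP; rewrite -subr_eq0; apply/eqP.
  (* After multiplication by l^2, the defect of the square identity is k + l times the defect of
     [t2], because n = 1 + 2 k + 2 l. *)
  transitivity ((k + l) * (l * n%:R - ((k + k) * l + l * (u * u) + k * ((1 + u) * (1 + u))))).
    by rewrite nv; ring.
  by rewrite t2 subrr mulr0.
(* A square is 0 or 1 modulo 4, but n = 3 + 4 x1. *)
move: sq; rewrite n3; move: (u + (1 + v)) => w.
have [q [b [-> b2]]] : exists q b : int, w = q + q + b /\ (b = 0 \/ b = 1).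
  by exists (w %/ 2)%Z, (w %% 2)%Z; split; lia.
rewrite expr2; case: b2 => ->; rewrite ?addr0 !(mulrDl, mulrDr); lia.
Qed.

(** * Indexed partitions *)

Lemma indexed_partition_cell (T : finType) (n : nat) (F : 'I_n.+1 -> {set T}) x :
  indexed_partition F -> exists i, forall j, (x \in F j) = (j == i).
Proof.
move=> [injF /and3P[/eqP covF trivF _]].
have : x \in cover [set F i | i : 'I_n.+1] by rewrite covF inE.
case/bigcupP => _ /imsetP[i _ ->] xFi; exists i => j.
apply/idP/eqP => [xFj | -> //]; apply: injF.
apply/eqP; apply: contraTT xFi => neqF.
have memF k : F k \in [set F i | i : 'I_n.+1] by apply: imset_f.
have /trivIsetP/(_ _ _ (memF j) (memF i) neqF) := trivF.
by move/disjointFr/(_ xFj) ->.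
Qed.

(** Surjectivity makes the fibres nonempty, hence also pairwise distinct. *)
Lemma indexed_partition_fibers (T : finType) (n : nat) (f : T -> 'I_n.+1) :
  (forall i, exists x, f x = i) -> indexed_partition (fun i => [set x | f x == i]).
Proof.
move=> surjf; split.
  move=> i j eqF; have [x fx] := surjf i.
  by have := in_set (fun x => f x == i) x; rewrite eqF inE fx eqxx => /eqP.
apply/and3P; split.
- apply/eqP/setP => x; rewrite inE; apply/bigcupP.
  by exists [set y | f y == f x]; rewrite ?imset_f // inE.
- apply/trivIsetP => _ _ /imsetP[i _ ->] /imsetP[j _ ->] neqF.
  apply/pred0Pn => -[x]; rewrite /= !inE => /andP[/eqP fi /eqP fj].
  by move: neqF; rewrite -fi -fj eqxx.
- apply/imsetP => -[i _ /setP eqF]; have [x fx] := surjf i.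
  by have := eqF x; rewrite !inE fx eqxx.
Qed.

(** * Adjacency matrices of relations *)

Section Adjacency.

Variable X : finType.
Implicit Types S : {set X * X}.

Definition adj S : 'M[int]_#|X| :=
  \matrix_(i, j) ((enum_val i, enum_val j) \in S)%:R.

Lemma adjM S S' i j : (adj S *m adj S') i j =
  #|[set z | ((enum_val i, z) \in S) && ((z, enum_val j) \in S')]|%:R.
Proof.
rewrite mxE -sum1_card natr_sum [RHS]big_mkcond /=.
rewrite [RHS](reindex (fun i : 'I_#|X| => enum_val i)) /=; last first.
  by exists enum_rank => x _; rewrite ?enum_valK ?enum_rankK.
apply: eq_bigr => z _; rewrite !mxE inE.
by case: (_ \in S); case: (_ \in S'); rewrite ?mulr0 ?mulr1.
Qed.

Lemma adj_rel_inv S : adj (rel_inv S) = (adj S)^T.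
Proof. by apply/matrixP => i j; rewrite !mxE inE. Qed.

Lemma adj_diag : adj (diag X) = 1%:M.
Proof. by apply/matrixP => i j; rewrite !mxE inE /= (inj_eq enum_val_inj). Qed.

Lemma adj_setT : adj setT = J.
Proof. by apply/matrixP => i j; rewrite !mxE inE. Qed.

(** The trace of S S'^T is the entrywise inner product of the two matrices, here with disjoint
    supports. *)
Lemma tr_adj_disjoint S S' :
  [disjoint S & S'] -> \tr (adj S *m (adj S')^T) = 0.
Proof.
move=> disjS; rewrite /mxtrace big1 // => i _; rewrite mxE big1 // => j _.
rewrite !mxE; case: (boolP (_ \in S)) => [inS | _]; last by rewrite mul0r.
by rewrite (disjointFr disjS inS) mulr0.
Qed.

(** Entries 0 and 1 equal their squares, so both traces count the pairs in [S]. *)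
Lemma tr_adj_self S : \tr (adj S *m (adj S)^T) = \tr (adj S *m (J : 'M_#|X|)).
Proof.
apply: eq_bigr => i _; rewrite !mxE; apply: eq_bigr => j _; rewrite !mxE.
by case: (_ \in S); rewrite ?mulr1 ?mulr0.
Qed.

End Adjacency.

(** * The adjacency algebra of a scheme *)

Section SchemeAdjacency.

Variables (X : finType) (d : nat) (R : 'I_d.+1 -> {set X * X}).
Hypothesis schR : assoc_scheme R.

Let cell := fun p => indexed_partition_cell p (scheme_partition schR).

Lemma scheme_disjoint i j : i != j -> [disjoint R i & R j].
Proof.
move=> neq_ij; apply/pred0Pn => -[p /= /andP[]]; have [k inR] := cell p.
by rewrite !inR => /eqP eqi /eqP eqj; rewrite eqi eqj eqxx in neq_ij.
Qed.

Lemma scheme_neq0 i : R i != set0.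
Proof.
have [_ /and3P[_ _]] := scheme_partition schR.
by apply: contraNneq => <-; rewrite imset_f.
Qed.

Lemma sum_scheme_mxE (c : 'I_d.+1 -> int) (x y : 'I_#|X|) k :
    (enum_val x, enum_val y) \in R k ->
  (\sum_i c i *: adj (R i)) x y = c k.
Proof.
have [k0 inR] := cell (enum_val x, enum_val y); rewrite inR => /eqP->.
rewrite summxE (bigD1 k0) //= big1 => [|i /negPf neqi].
  by rewrite !mxE inR eqxx mulr1 addr0.
by rewrite !mxE inR neqi mulr0.
Qed.

Lemma sum_scheme : \sum_i adj (R i) = J.
Proof.
apply/matrixP => x y; have [k inR] := cell (enum_val x, enum_val y).
have := @sum_scheme_mxE (fun=> 1) x y k.
by rewrite inR mxE => /(_ (eqxx _)) <-; congr (fun_of_matrix _ x y);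
  apply: eq_bigr => i _; rewrite scale1r.
Qed.

Lemma scheme_mul i j :
  exists c : 'I_d.+1 -> int, adj (R i) *m adj (R j) = \sum_k c k *: adj (R k).
Proof.
have [p inter] := fin_all_exists (scheme_inter schR i j).
exists (fun k => (p k)%:R); apply/matrixP => x y.
have [k inR] := cell (enum_val x, enum_val y).
have xyk : (enum_val x, enum_val y) \in R k by rewrite inR.
by rewrite (sum_scheme_mxE _ xyk) adjM (inter k _ _ xyk).
Qed.

(** The row sum is the intersection number of [i] and its inverse index over the diagonal class; it
    is positive since [R i] is nonempty. *)
Lemma scheme_row_sum i : exists2 k : int, 0 < k & adj (R i) *m (J : 'M_#|X|) = k *: J.
Proof.
have [i' inv_i] := scheme_inv schR i.
have [p inter] := scheme_inter schR i i' ord0.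
have row x : #|[set z | (x, z) \in R i]| = p.
  rewrite -(inter x x); last by rewrite (scheme_diag schR) inE.
  by apply: eq_card => z; rewrite !inE -inv_i inE andbb.
exists p%:R; last first.
  apply/matrixP => x y; rewrite -adj_setT adjM !mxE !inE mulr1 -(row (enum_val x)).
  by congr (_%:R); apply: eq_card => z; rewrite !inE andbT.
have /set0Pn[[x z] xz] := scheme_neq0 i.
by rewrite ltr0n -(row x); apply/card_gt0P; exists z; rewrite inE.
Qed.

Lemma scheme_card_gt0 : (0 < #|X|)%N.
Proof. exact: ltnW (scheme_card schR). Qed.

(** Column sums are row sums of the inverse class; evaluating J A J in two ways shows that the two
    constants agree. *)
Lemma scheme_valency i : exists k : int,
  [/\ 0 < k, adj (R i) *m (J : 'M_#|X|) = k *: J & (J : 'M_#|X|) *m adj (R i) = k *: J].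
Proof.
have [k k_gt0 AJ] := scheme_row_sum i; exists k; split=> //.
have [i' inv_i] := scheme_inv schR i.
have [k' _ ] := scheme_row_sum i'; rewrite -inv_i adj_rel_inv => AtJ'.
have JA : (J : 'M_#|X|) *m adj (R i) = k' *: J.
  by rewrite -[LHS]trmxK trmx_mul trmxJ AtJ' linearZ /= trmxJ.
have := mulmxA (J : 'M_#|X|) (adj (R i)) (J : 'M_#|X|).
rewrite AJ JA -scalemxAr -scalemxAl => eqJ; congr (_ *: _).
apply/esym/eqP; rewrite -subr_eq0; apply/eqP.
apply: (@scale_mx_eq0 _ _ _ ((J : 'M_#|X|) *m (J : 'M_#|X|))).
  by rewrite scalerBl eqJ subrr.
rewrite mulJJ; apply/eqP => /scale_mx_eq0/(_ (J_neq0 scheme_card_gt0))/eqP.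
exact/negP/(natn_neq0 scheme_card_gt0).
Qed.

Lemma tr_scheme i : i != ord0 -> \tr (adj (R i)) = 0.
Proof.
move=> i0; rewrite -[adj _]mulmx1 -(trmx1 _ #|X|) -adj_diag -(scheme_diag schR).
exact/tr_adj_disjoint/scheme_disjoint.
Qed.

End SchemeAdjacency.

Lemma adj_fusion (X : finType) (d e : nat) (R : 'I_d.+1 -> {set X * X})
    (L : 'I_e.+1 -> {set 'I_d.+1}) i :
  assoc_scheme R -> adj (fusion R L i) = \sum_(a in L i) adj (R a).
Proof.
move=> schR; apply/matrixP => x y; rewrite summxE !mxE.
have [k inR] := indexed_partition_cell (enum_val x, enum_val y) (scheme_partition schR).
have -> : ((enum_val x, enum_val y) \in fusion R L i) = (k \in L i).
  apply/bigcupP/idP => [[a La]|Lk]; first by rewrite inR => /eqP <-.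
  by exists k; rewrite ?inR.
rewrite big_mkcond (bigD1 k) //= big1 => [|j /negPf neqj]; rewrite ?mxE ?inR.
  by rewrite eqxx addr0; case: ifP.
by rewrite neqj; case: ifP.
Qed.

(** * Fusions of the four classes into a tournament and its transpose *)

Section Tournament.

Variables (X : finType) (R : 'I_5 -> {set X * X}) (s : 'I_5 -> 'I_5) (a b : 'I_5).
Hypothesis schR : assoc_scheme R.
Hypothesis inv_s : forall i, rel_inv (R i) = R (s i).
Hypotheses (s_invol : involutive s) (s0 : s ord0 = ord0).
Hypotheses (a0 : a != ord0) (b0 : b != ord0) (neq_ab : a != b).
Hypothesis s_ab : forall i, i != ord0 -> (s i \in [set a; b]) = (i \notin [set a; b]).

(** The fibres of [f] are the blocks of the fusion; by [s_ab], [s] exchanges the two nontrivial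
    ones. *)
Let f (i : 'I_5) : 'I_3 :=
  if i == ord0 then ord0 else if i \in [set a; b] then inord 1 else inord 2.

Let L (i : 'I_3) : {set 'I_5} := [set c | f c == i].

Let s_eq0 i : (s i == ord0) = (i == ord0).
Proof. by rewrite -{1}s0 (inj_eq (can_inj s_invol)). Qed.

Lemma tournament_admissible : admissible R L.
Proof.
have f_s i : f (s i) = if f i == ord0 then ord0 else
    if f i == inord 1 then inord 2 else inord 1.
  rewrite /f s_eq0; case: (eqVneq i ord0) => [_ | i0]; first by rewrite eqxx.
  by rewrite s_ab //; case: (_ \in _); rewrite -!val_eqE /= !inordK.
(* The action of [s] on block labels. *)
pose t (i : 'I_3) : 'I_3 := if i == ord0 then ord0 else
    if i == inord 1 then inord 2 else inord 1.
have tK : involutive t.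
  move=> i; apply/val_inj; rewrite /t -!val_eqE /= !inordK //.
  by case: i => [[|[|[|i]]]] //= ?; rewrite ?inordK.
split.
- apply: indexed_partition_fibers => -[[|[|[|i]]]] // lti.
  + by exists ord0; apply/val_inj.
  + exists a; apply/val_inj; rewrite /f (negPf a0) !inE eqxx /=.
    by rewrite inordK.
  + exists (s a); apply/val_inj.
    rewrite /f s_eq0 (negPf a0) s_ab // !inE eqxx /=.
    by rewrite inordK.
- apply/setP => i; rewrite !inE /f; case: (i == ord0) => //.
  by case: (_ \in _); rewrite -val_eqE /= inordK.
- move=> i; exists (t i); apply/setP => c; rewrite !inE.
  have [injR _] := scheme_partition schR.
  have -> : (f c == t i) = (f (s c) == i) by rewrite f_s -/(t (f c)) (can2_eq tK tK).
  apply/existsP/idP => [[c']|fsc].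
    by rewrite !inE inv_s => /andP[fc' /eqP/injR <-]; rewrite s_invol.
  by exists (s c); rewrite !inE fsc inv_s s_invol eqxx.
Qed.

Hypothesis amR : amorphous R.

(** The fusion scheme has adjacency matrices [I], [T], [T^T], so T T^T is a product of two of its
    classes and expands in all three. *)
Lemma tournament_product :
  let T := adj (R a) + adj (R b) in
  exists c0 c1 c2 : int, T *m T^T = c0%:M + c1 *: T + c2 *: T^T.
Proof.
move=> T; have schF := amR tournament_admissible.
have adj0 : adj (fusion R L ord0) = 1%:M by rewrite (scheme_diag schF) adj_diag.
have adj1 : adj (fusion R L (inord 1)) = T.
  rewrite adj_fusion //; have -> : L (inord 1) = [set a; b].
    apply/setP => c; rewrite inE /f; case: (eqVneq c ord0) => [-> | _].
      by rewrite -val_eqE /= inordK // !inE !(eq_sym ord0) (negPf a0) (negPf b0).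
    by case: (_ \in _); rewrite -val_eqE /= !inordK.
  by rewrite big_setU1 ?inE //= big_set1.
have eq2 : lift ord0 (lift ord0 ord0) = inord 2 :> 'I_3 by apply/val_inj; rewrite /= inordK.
have eq1 : lift ord0 ord0 = inord 1 :> 'I_3 by apply/val_inj; rewrite /= inordK.
have adj2 : adj (fusion R L (inord 2)) = T^T.
  rewrite adj_fusion //; have -> : L (inord 2) = [set s a; s b].
    apply/setP => c; rewrite inE /f; case: (eqVneq c ord0) => [-> | c0].
      by rewrite -val_eqE /= inordK // !inE !(eq_sym ord0) !s_eq0 (negPf a0) (negPf b0).
    have -> : (c \in [set s a; s b]) = (s c \in [set a; b]).
      by rewrite !inE -!(can2_eq s_invol s_invol).
    by rewrite s_ab //; case: (_ \in _); rewrite -val_eqE /= !inordK.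
  rewrite big_setU1 ?inE ?(inj_eq (can_inj s_invol)) //= big_set1.
  by rewrite -!inv_s !adj_rel_inv raddfD.
have [c eqc] := scheme_mul schF (inord 1) (inord 2).
exists (c ord0), (c (inord 1)), (c (inord 2)).
rewrite adj1 adj2 in eqc; rewrite eqc !big_ord_recl big_ord0 addr0 eq2 eq1 adj0 adj1 adj2.
by rewrite scalemx1 addrA.
Qed.

End Tournament.

(** * The skew-symmetric scheme with four classes *)

Theorem theorem1p1 :
  ~ exists (X : finType) (R : 'I_5 -> {set X * X}),
      [/\ assoc_scheme R, skew_symmetric R & amorphous R].
Proof.
move=> [X [R [schR skewR amR]]].
have [s inv_s] := fin_all_exists (scheme_inv schR).
have [injR _] := scheme_partition schR.
have s_invol : involutive s.
  move=> i; apply: injR; rewrite -!inv_s; apply/setP => -[x y].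
  by rewrite !inE.
have s0 : s ord0 = ord0.
  by apply: injR; rewrite -inv_s; apply/skewR.
have s_neq i : i != ord0 -> s i != i.
  by apply: contra => /eqP si; apply/eqP/skewR; rewrite /symmetric_rel inv_s si.
have s_eq i j : (s i == j) = (i == s j) by apply: can2_eq.
have s_eq0 i : (s i == ord0) = (i == ord0) by rewrite s_eq s0.
have [a a0] : exists a : 'I_5, a != ord0 by exists (lift ord0 ord0).
(* The excluded set has at most three of the five indices. *)
have [b] : exists b, b \in ~: [set ord0; a; s a].
  apply/card_gt0P; rewrite cardsCs setCK card_ord subn_gt0.
  by rewrite (leq_ltn_trans (leq_card_setU _ _)) // cards1 cards2; case: (_ != _).
rewrite !inE !negb_or -andbA => /and3P[b0 ba bsa].
have ab : a != b by rewrite eq_sym.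
have sab : s a != b by rewrite eq_sym.
have asb : a != s b by rewrite -s_eq.
have sasb : s a != s b by rewrite s_eq s_invol.
have saa := s_neq _ a0; have sbb := s_neq _ b0.
(* The nonzero indices form two orbits of [s], so these five terms exhaust the sum. *)
have enum5 (V : zmodType) (F : 'I_5 -> V) :
    \sum_i F i = F ord0 + F a + F (s a) + F b + F (s b).
  have uniq5 : uniq [:: ord0; a; s a; b; s b].
    by rewrite /= !inE !negb_or !(eq_sym ord0) !s_eq0 a0 b0 eq_sym saa ab asb sab sasb
      (eq_sym b) sbb.
  have mem5 : [:: ord0; a; s a; b; s b] =i predT.
    apply/subset_cardP; first by rewrite (card_uniqP uniq5) card_ord.
    exact/subsetP.
  have perm5 : perm_eq (index_enum 'I_5) [:: ord0; a; s a; b; s b].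
    apply: uniq_perm => //; first exact: index_enum_uniq.
    by move=> i; rewrite mem_index_enum mem5.
  by rewrite (perm_big _ perm5) /= !big_cons big_nil addr0 !addrA.
have sum_all : 1%:M + (adj (R a) + (adj (R a))^T) + (adj (R b) + (adj (R b))^T) = J.
  by rewrite -(sum_scheme schR) enum5 -!inv_s !adj_rel_inv (scheme_diag schR) adj_diag !addrA.
have span i j : in_span (adj (R a)) (adj (R b)) (adj (R i) *m adj (R j)).
  have [c ->] := scheme_mul schR i j; rewrite enum5 -!inv_s !adj_rel_inv.
  rewrite (scheme_diag schR) adj_diag scalemx1.
  by exists (c ord0), (c a), (c (s a)), (c b), (c (s b)).
have adjs i : (adj (R i))^T = adj (R (s i)) by rewrite -inv_s adj_rel_inv.
have adjK i : adj (R i) = (adj (R (s i)))^T by rewrite adjs s_invol.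
(* Applied to the indicator of [i], [enum5] has sum 1, so [i] is one of the listed indices. *)
have mem5 i : i != ord0 -> [|| i == a, i == s a, i == b | i == s b].
  have := enum5 int (fun j => (j == i)%:R); rewrite (bigD1 i) //= eqxx big1; last first.
    by move=> j /negPf ->.
  rewrite !(eq_sym _ i) => + /negPf i0; rewrite i0.
  by case: (i == a); case: (i == s a); case: (i == b); case: (i == s b).
have disj i j : i != j -> \tr (adj (R i) *m (adj (R j))^T) = 0.
  by move=> neqij; apply/tr_adj_disjoint/scheme_disjoint.
have [k [k_gt0 AJ JA]] := scheme_valency schR a.
have [l [l_gt0 BJ JB]] := scheme_valency schR b.
(* Both {a, b} and {a, s b} take one index from each orbit of [s], as a tournament fusion
   requires. *)
have sab_T i : i != ord0 -> (s i \in [set a; b]) = (i \notin [set a; b]).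
  move=> /mem5; rewrite !inE !s_eq => /or4P[]/eqP->; rewrite ?s_invol ?eqxx ?orbT ?orTb /=.
  - by rewrite (eq_sym a) (negPf saa) (negPf asb).
  - by rewrite (negPf saa) (negPf sab).
  - by rewrite (negPf bsa) (eq_sym b) (negPf sbb).
  - by rewrite (eq_sym (s b)) (negPf asb) (negPf sbb).
have sab_S i : i != ord0 -> (s i \in [set a; s b]) = (i \notin [set a; s b]).
  move=> /mem5; rewrite !inE !s_eq => /or4P[]/eqP->; rewrite ?s_invol ?eqxx ?orbT ?orTb /=.
  - by rewrite (eq_sym a) (negPf saa) (negPf ab).
  - by rewrite (negPf saa) (negPf sasb).
  - by rewrite (eq_sym b a) (negPf ab) (eq_sym b) (negPf sbb).
  - by rewrite (inj_eq (can_inj s_invol)) (eq_sym b) (negPf ab) (negPf sbb).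
have sb0 : s b != ord0 by rewrite s_eq0.
have [x0 [x1 [x2 eqT]]] := tournament_product schR inv_s s_invol s0 a0 b0 ab sab_T amR.
have [z0 [z1 [z2 eqS]]] := tournament_product schR inv_s s_invol s0 a0 sb0 asb sab_S amR.
rewrite -adjs in eqS.
apply: (skew_pair_absurd (scheme_card_gt0 schR) k_gt0 l_gt0 sum_all AJ JA BJ JB
  _ _ _ _ _ _ _ _ _ _ _ _ _ _ eqT eqS); rewrite ?adjs //.
- exact: tr_scheme.
- exact: tr_scheme.
(* With the second factor written as a transpose, this is the inner product of two distinct
   classes. *)
- by rewrite {2}adjK; apply: disj; rewrite eq_sym.
- by rewrite {2}adjK; apply: disj; rewrite eq_sym.
- by rewrite -adjs tr_adj_self; apply: mxtrace_mulJ.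
- by rewrite -adjs tr_adj_self; apply: mxtrace_mulJ.
- by rewrite [adj (R b)]adjK; apply: disj.
- by rewrite -adjs; apply: disj.
Qed.
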